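(* Let $f\colon\mathbb{N}_0\to\mathbb{N}_0$ be a multiplicative arithmetic function (i.e. $f(1)=1$ and $f(mn)=f(m)f(n)$ whenever $m,n\in\mathbb{N}$ are coprime) such that for all primes $p$ and positive integers $\alpha$: (I) $f(p^{\alpha})<p^{\alpha}$; (II) $f(p)\mid f(p^{\alpha})$; (III) if $q$ is a prime with $q\mid f(p^{\alpha})$, then $q\mid p\,f(p)$; and moreover (IV) $f(0)=0$. For $n\in\mathbb{N}$ let $H(n)=\lim_{m\to\infty} f^m(n)$. Then the function $H\colon\mathbb{N}\to\{0,1\}$ is completely multiplicative, i.e. $H(xy)=H(x)H(y)$ for all $x,y\in\mathbb{N}$.
   Context: $\mathbb{N}$ denotes the positive integers and $\mathbb{N}_0$ the nonnegative integers. $f^0(n)=n$ and $f^{k+1}(n)=f(f^k(n))$ for all nonnegative integers $k,n$. Under the hypotheses, for each $n\in\mathbb{N}$ the sequence $f^m(n)$ is eventually constant with value $f^n(n)\in\{0,1\}$, so $H(n)=f^n(n)$ is well defined and lies in $\{0,1\}$. *)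

(* Defs.v *)
From mathcomp Require Import all_boot all_order all_algebra.
From mathcomp Require Import all_classical all_reals all_analysis.

Set Implicit Arguments.
Unset Strict Implicit.
Unset Printing Implicit Defensive.

Local Open Scope classical_set_scope.
Local Open Scope nat_scope.

Definition multiplicative_arith (f : nat -> nat) : Prop :=
  f 1 = 1 /\
  forall m n : nat, 0 < m -> 0 < n -> coprime m n -> f (m * n) = f m * f n.

(* The limit is taken in the discrete topology of nat. *)
Definition iter_lim (f : nat -> nat) (n : nat) : nat :=
  lim (iter m f n @[m --> \oo]).

(* Main.v *)
Require Import Defs.
From mathcomp Require Import all_boot all_order all_algebra.
From mathcomp Require Import all_classical all_reals all_analysis.

Local Open Scope classical_set_scope.
Local Open Scope nat_scope.

(* A number x satisfies H(x) = 1 iff every prime divisor of x does; complete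
   multiplicativity follows at once.  The equivalence is proved by strong
   induction on x, using f x < x and H(f x) = H(x): by (III) every prime divisor
   of f x divides p * f p for some prime p dividing x, and by (II) f p divides
   f x for every such p. *)

Lemma iter_cvg_fixpoint {f : nat -> nat} {n k c : nat} :
  iter k f n = c -> f c = c -> iter m f n @[m --> \oo] --> c.
Proof.
move=> fkn fc; apply: cvg_near_cst; near=> m.
have km : k <= m by near: m; exact: nbhs_infty_ge.
by rewrite -(subnK km) iterD fkn iter_fix.
Unshelve. all: by end_near. Qed.

Lemma iter_lim_fixpoint {f : nat -> nat} {n k c : nat} :
  iter k f n = c -> f c = c -> iter_lim f n = c.
Proof.
by move=> fkn fc; apply: cvg_lim (iter_cvg_fixpoint fkn fc); exact: discrete_hausdorff.
Qed.

(** Splitting off the full power of [p] leaves a coprime cofactor, so multiplicativity applies;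
    [m < n] makes this usable in strong induction. *)
Lemma multiplicative_arith_split {f : nat -> nat} {p n : nat} :
  multiplicative_arith f -> prime p -> 0 < n -> p %| n ->
  exists a m, [/\ 0 < a, 0 < m < n, n = p ^ a * m & f n = f (p ^ a) * f m].
Proof.
move=> [_ fM] pp n0 pn; have [m cpm nE] := pfactor_coprime pp n0.
have a0 : 0 < logn p n by rewrite logn_gt0 mem_primes pp n0.
have m0 : 0 < m by move: n0; rewrite nE muln_gt0 => /andP[].
have pa0 : 0 < p ^ logn p n by rewrite expn_gt0 prime_gt0.
have nE' : n = p ^ logn p n * m by rewrite mulnC.
exists (logn p n), m; split=> //.
  by rewrite m0 [X in _ < X]nE' ltn_Pmull // -(expn0 p) ltn_exp2l // prime_gt1.
by rewrite [X in f X = _]nE' fM // coprimeXl.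
Qed.

Section CompleteMultiplicativity.
Set Implicit Arguments.
Unset Strict Implicit.
Variable f : nat -> nat.
Hypothesis f_mult : multiplicative_arith f.
Hypothesis fI : forall p a : nat, prime p -> 0 < a -> f (p ^ a) < p ^ a.
Hypothesis fII : forall p a : nat, prime p -> 0 < a -> f p %| f (p ^ a).
Hypothesis fIII : forall p a q : nat, prime p -> 0 < a -> prime q ->
  q %| f (p ^ a) -> q %| p * f p.
Hypothesis fIV : f 0 = 0.

Let f1 : f 1 = 1 := proj1 f_mult.

Lemma f_prime_lt p : prime p -> f p < p.
Proof. by move=> pp; have := fI pp (ltnSn 0); rewrite expn1. Qed.

Lemma f_lt n : 1 < n -> f n < n.
Proof.
elim/ltn_ind: n => n IH n1; have pp := pdiv_prime n1.
have [a [m [a0 /andP[m0 mn] nE ->]]] :=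
  multiplicative_arith_split f_mult pp (ltnW n1) (pdiv_dvd n).
have fm : f m <= m.
  case: (ltnP 1 m) => [/(IH _ mn)/ltnW//|m1].
  have -> : m = 1 by apply/eqP; rewrite eqn_leq m1.
  by rewrite f1.
(* Strictness comes from the prime power alone: the cofactor may be 1, where [f] gives equality. *)
rewrite [X in _ < X]nE; apply: (@leq_ltn_trans (f (pdiv n ^ a) * m)).
  by rewrite leq_mul2l fm orbT.
by rewrite ltn_pmul2r // fI.
Qed.

Lemma f_prime_dvd p n : prime p -> 0 < n -> p %| n -> f p %| f n.
Proof.
move=> pp n0 pn; have [a [m [a0 _ _ ->]]] := multiplicative_arith_split f_mult pp n0 pn.
by rewrite dvdn_mulr // fII.
Qed.

(** Extends (III) from prime powers to all positive [n]: a prime dividing [f (p ^ a) * f m] divides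
    one of the factors. *)
Lemma prime_dvd_f q n : prime q -> 0 < n -> q %| f n ->
  exists p, [/\ prime p, p %| n & q %| p * f p].
Proof.
move=> pq; elim/ltn_ind: n => n IH n0.
case: (ltnP 1 n) => [n1|n1]; last first.
  have -> : n = 1 by apply/eqP; rewrite eqn_leq n1.
  by rewrite f1 dvdn1 => /eqP q1; rewrite q1 in pq.
have pp := pdiv_prime n1.
have [a [m [a0 /andP[m0 mn] nE ->]]] :=
  multiplicative_arith_split f_mult pp n0 (pdiv_dvd n).
rewrite Euclid_dvdM // => /orP[qp|/(IH _ mn m0)[p [p_pr pm qpp]]].
  by exists (pdiv n); split; rewrite ?pdiv_dvd //; apply: fIII qp.
by exists p; split=> //; rewrite nE dvdn_mull.
Qed.

(* If f n = 0, every prime q divides f n; taking q > n forces f p = 0 for some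
   prime p dividing n. *)
Lemma f_gt0 n : 0 < n -> (forall p, prime p -> p %| n -> 0 < f p) -> 0 < f n.
Proof.
move=> n0 fp; rewrite lt0n; apply/negP => /eqP fn0.
have [q nq pq] := prime_above n.
have [|p [pp pn]] := prime_dvd_f pq n0; first by rewrite fn0.
have pltq : p < q := leq_ltn_trans (dvdn_leq n0 pn) nq.
rewrite Euclid_dvdM // => /orP[] /dvdn_leq.
  by move/(_ (prime_gt0 pp)); rewrite leqNgt pltq.
by move/(_ (fp _ pp pn)); rewrite leqNgt (ltn_trans (f_prime_lt pp)).
Qed.

(** The iterates strictly decrease as long as they exceed 1. *)
Lemma iter_f_01 n : exists k, iter k f n = 0 \/ iter k f n = 1.
Proof.
elim/ltn_ind: n => [[|[|n]]] IH; [by exists 0; left|by exists 0; right|].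
by have [k Hk] := IH _ (f_lt (ltn0Sn n : 1 < n.+2)); exists k.+1; rewrite iterSr.
Qed.

(** Both 0 and 1 are fixed by [f], so the orbit stabilises once it reaches either; the orbit of
    [f n] is a tail of that of [n]. *)
Lemma iter_lim_f n :
  [/\ iter m f n @[m --> \oo] --> iter_lim f n,
      iter_lim f n = 0 \/ iter_lim f n = 1 & iter_lim f (f n) = iter_lim f n].
Proof.
have [k H] := iter_f_01 n.
have [c Hk c01] : exists2 c, iter k f n = c & c = 0 \/ c = 1 by exists (iter k f n).
have fc : f c = c by case: c01 => ->.
have HSk : iter k f (f n) = c by rewrite -iterSr iterS Hk.
rewrite (iter_lim_fixpoint Hk fc) (iter_lim_fixpoint HSk fc).
by split=> //; apply: iter_cvg_fixpoint Hk fc.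
Qed.

Lemma iter_lim0 : iter_lim f 0 = 0.
Proof. exact: (@iter_lim_fixpoint f 0 0 0). Qed.

Lemma iter_lim1 : iter_lim f 1 = 1.
Proof. exact: (@iter_lim_fixpoint f 1 0 1). Qed.

(** Supplies the positivity of [f n] and [f p] that the induction below requires. *)
Lemma iter_lim_gt0 n : iter_lim f n = 1 -> 0 < n.
Proof. by case: n => //; rewrite iter_lim0. Qed.

Lemma iter_lim_eq1P n : 0 < n ->
  iter_lim f n = 1 <-> (forall p, prime p -> p %| n -> iter_lim f p = 1).
Proof.
elim/ltn_ind: n => n IH n0.
case: (ltnP 1 n) => [n1|n1]; last first.
  have -> : n = 1 by apply/eqP; rewrite eqn_leq n1.
  split=> [_ p pp|_]; last exact: iter_lim1.
  by rewrite dvdn1 => /eqP p1; rewrite p1 in pp.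
have limf k : iter_lim f (f k) = iter_lim f k by have [] := iter_lim_f k.
have fpn p : prime p -> p %| n -> f p < n.
  by move=> pp pn; apply: leq_trans (f_prime_lt pp) (dvdn_leq n0 pn).
split=> [Hn p pp pn|Hp].
  (* The induction hypothesis is used twice: at [f n], all of whose primes have limit 1, then at
     [f p], whose primes are among them. *)
  rewrite -limf in Hn; have fn0 := iter_lim_gt0 Hn.
  have fpfn := f_prime_dvd pp n0 pn.
  rewrite -limf; apply/(IH _ (fpn _ pp pn) (dvdn_gt0 fn0 fpfn)) => q pq qfp.
  by apply: (IH _ (f_lt n1) fn0).1 => //; apply: dvdn_trans fpfn.
have fp0 p : prime p -> p %| n -> 0 < f p.
  by move=> pp pn; apply: iter_lim_gt0; rewrite limf Hp.
(* A prime [q] of [f n] either equals some prime [p] of [n] or divides [f p]; in the latter case the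
   induction hypothesis at [f p] applies. *)
rewrite -limf; apply/(IH _ (f_lt n1) (f_gt0 n0 fp0)) => q pq qfn.
have [p [pp pn]] := prime_dvd_f pq n0 qfn.
rewrite Euclid_dvdM // => /orP[|qfp].
  by rewrite dvdn_prime2 // => /eqP ->; apply: Hp.
by apply: (IH _ (fpn _ pp pn) (fp0 _ pp pn)).1 => //; rewrite limf Hp.
Qed.

Lemma iter_limM x y : 0 < x -> 0 < y ->
  iter_lim f (x * y) = iter_lim f x * iter_lim f y.
Proof.
move=> x0 y0; have xy0 : 0 < x * y by rewrite muln_gt0 x0.
(* For values in {0, 1} this equivalence is the product formula; it holds because a prime divides
   [x * y] iff it divides [x] or [y]. *)
have xyE : iter_lim f (x * y) = 1 <-> iter_lim f x = 1 /\ iter_lim f y = 1.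
  split=> [/(iter_lim_eq1P xy0) H|[/(iter_lim_eq1P x0) Hx /(iter_lim_eq1P y0) Hy]].
    split; [apply/(iter_lim_eq1P x0)|apply/(iter_lim_eq1P y0)] => p pp pd;
    by apply: H => //; rewrite ?(dvdn_mulr _ pd) ?(dvdn_mull _ pd).
  apply/(iter_lim_eq1P xy0) => p pp.
  by rewrite Euclid_dvdM // => /orP[]; [apply: Hx|apply: Hy].
have [_ Hx _] := iter_lim_f x; have [_ Hy _] := iter_lim_f y.
have [_ Hxy _] := iter_lim_f (x * y).
move: xyE; case: Hx => ->; case: Hy => ->; case: Hxy => -> [xy1 xy2] //=;
by [case: (xy1 erefl)|have := xy2 (conj erefl erefl)].
Qed.

End CompleteMultiplicativity.

Theorem theorem1p3 (f : nat -> nat)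
    (f_mult : multiplicative_arith f)
    (fI : forall p a : nat, prime p -> 0 < a -> f (p ^ a) < p ^ a)
    (fII : forall p a : nat, prime p -> 0 < a -> f p %| f (p ^ a))
    (fIII : forall p a q : nat, prime p -> 0 < a -> prime q ->
       q %| f (p ^ a) -> q %| p * f p)
    (fIV : f 0 = 0) :
  (forall n : nat, 0 < n ->
     iter m f n @[m --> \oo] --> iter_lim f n /\
     (iter_lim f n = 0 \/ iter_lim f n = 1)) /\
  (forall x y : nat, 0 < x -> 0 < y ->
     iter_lim f (x * y) = iter_lim f x * iter_lim f y).
Proof.
split=> [n _|x y]; last exact: iter_limM.
by have [] := iter_lim_f f_mult fI fIV n.
Qed.
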